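(* Let $n_U := |V(\Phi)|$ be the number of extreme points of $\Phi$. The mapping-based column-and-constraint generation (C&CG) algorithm described in the context generates the optimal solution to the two-stage robust optimization problem with decision-dependent uncertainty $$\min_{x,C,\tau}\ \Big\{ f(x)+\sum_{i\in\mathcal I} C_i+\max_{u\in\mathcal U(\tau)}\ \min_{y\in\mathcal Y(x,u)} g(y)\Big\}\quad\text{s.t. } x\in\mathcal X\cap\tilde{\mathcal X}_R,\ \ C_i\ge h_i(\tau_i),\ \ 0\le\tau_i\le1\ \ (\forall i\in\mathcal I)$$ within $\mathcal O(n_U)$ iterations.
   Context: **Index sets and data.** $\mathcal I=\{1,\dots,I\}$ (agents), $\mathcal T=\{1,\dots,T\}$ (periods). The given parameters are the probability parameters $\delta,\xi$, the cost parameter $\hat m$, the variances $\sigma_{U_i}^2$ ($i\in\mathcal I$), the operator's original forecasts $\overline u_{it}$ and the agents' predictions $u_{it}^{pre}$. $\mathcal X$ is the feasible set of the first-stage variable $x$, and $f$ is the first-stage cost. The further first-stage variables are the payments $C=(C_i)_{i\in\mathcal I}$ and prediction accuracies $\tau=(\tau_i)_{i\in\mathcal I}$. The uncertainty is $u=(u_{it})_{i\in\mathcal I,t\in\mathcal T}$, and $y\in\mathbb R^{n_y}$ is the second-stage variable. **Second stage.** It is a linear program: $g(y)=c^\top y$ and $\mathcal Y(x,u)=\{y\in\mathbb R^{n_y}: Ax+By+Du\le q\}$, with $A,B,D,q,c$ given matrices/vectors of compatible sizes. **Prediction cost.** $h_i(\tau_i)=\dfrac{\hat m}{\sigma_{U_i}^2}\dfrac{\tau_i}{1-\tau_i}$.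 **Decision-dependent uncertainty set.** Put $$u_{it}^e(\tau_i)=(1-\tau_i)\overline u_{it}+\tau_i u_{it}^{pre},\qquad u_i^h(\tau_i)=\sqrt{\frac{(1-\tau_i)^2\sigma_{U_i}^2+\tau_i^2\sigma_{\epsilon_i}^2}{1-\delta}},$$ where $\sigma_{\epsilon_i}^2$ (the variance of agent $i$'s prediction error) is related to $\tau_i$ by $\tau_i=\sigma_{U_i}^2/(\sigma_{U_i}^2+\sigma_{\epsilon_i}^2)\in[0,1]$; equivalently $u_i^h(\tau_i)=\sqrt{(1-\tau_i)\sigma_{U_i}^2/(1-\delta)}$. Let $$\Gamma_S=\sqrt{\frac{I(1-\delta)(1+I-I\xi)}{1-\xi}},\qquad \Gamma_T=\sqrt{\frac{T(1-\delta)(1+T-T\xi)}{1-\xi}}.$$ Let $\Phi$ be the set of all $\phi=(\phi_{it})_{i\in\mathcal I,t\in\mathcal T}$ for which there exists $\psi=(\psi_{it})$ with $$-1\le\phi_{it}\le1,\ \ \phi_{it}\le\psi_{it},\ \ -\phi_{it}\le\psi_{it}\ (\forall i,t),\quad \sum_{i\in\mathcal I}\psi_{it}\le\Gamma_S\ (\forall t),\quad \sum_{t\in\mathcal T}\psi_{it}\le\Gamma_T\ (\forall i),$$ and let $V(\Phi)$ be its vertex set. Then $$\mathcal U(\tau)=\{u:\ u_{it}=u_{it}^e(\tau_i)+u_i^h(\tau_i)\phi_{it}\ \forall i,t,\ \ \phi\in\Phi\}.$$ Vector notation: $u=u^e(\tau)+u^h(\tau)\phi$ means $u_{it}=u_{it}^e(\tau_i)+u_i^h(\tau_i)\phi_{it}$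 for all $i,t$. **Robust feasible set.** $\tilde{\mathcal X}_R=\{x:\ \mathcal Y(x,u)\neq\emptyset\ \ \forall u\in\mathcal U(\tau)\}$ (it depends on $\tau$). **Auxiliary problems for given $(x,\tau)$.** Below, $\perp$ denotes complementarity, and $1$ in $1^\top s$ and on right-hand sides is the all-ones vector. - Feasibility-check problem $\mathbf{FC}$, equivalent to $\max_{u\in\mathcal U(\tau)}\min_{y,s}\{1^\top s: Ax+By+Du-s\le q,\ s\ge0\}$ via the KKT conditions of the inner problem: $$\max_{u\in\mathcal U(\tau),\,y,\,s,\,\nu,\,\mu} 1^\top s\ \ \text{s.t. } B^\top\nu=0,\ -\nu+\mu=1,\ 0\le-\nu\perp[-(Ax+By+Du-s)+q]\ge0,\ 0\le\mu\perp s\ge0.$$ - Sub-problem $\mathbf{SP}$, equivalent to $\max_{u\in\mathcal U(\tau)}\min_{y\in\mathcal Y(x,u)}c^\top y$ in the same way: $$\max_{u\in\mathcal U(\tau),\,y,\,\nu} c^\top y\ \ \text{s.t. } B^\top\nu=c,\ 0\le-\nu\perp[-(Ax+By+Du)+q]\ge0.$$ The optimal $u^*$ of $\mathbf{FC}$ or $\mathbf{SP}$ (the worst-case scenario) can be reached at a vertex of $\mathcal U(\tau)$, and it is taken there: $u^*=u^e(\tau)+u^h(\tau)\phi^*$ with corresponding $\phi^*\in V(\Phi)$. **Master problem $\mathbf{MP}$** with stored $\phi_1^*,\dots,\phi_K^*$: $$\min_{x,C,\tau,\zeta,y^k,u^k} f(x)+\sum_{i\in\mathcal I}C_i+\zeta$$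 subject to $x\in\mathcal X$; $C_i\ge h_i(\tau_i)$ and $\tau_i\in[0,1]$ for all $i\in\mathcal I$; and, for all $k=1,\dots,K$: $\zeta\ge c^\top y^k$, $Ax+By^k+Du^k\le q$, $u^k=u^e(\tau)+u^h(\tau)\phi_k^*$. **Mapping-based C&CG algorithm.** 1. Initiation: error tolerance $\epsilon>0$; $K=0$; $UB_K=+\infty$. 2. Solve $\mathbf{MP}$. Derive the optimal solution $(x_{K+1}^*,C_{K+1}^*,\tau_{K+1}^*,\zeta_{K+1}^*,y^{1*},\dots,y^{K*},u^{1*},\dots,u^{K*})$ and set $LB_{K+1}=f(x_{K+1}^* )+\sum_{i\in\mathcal I}C_{i,K+1}^*+\zeta_{K+1}^*$. 3. Solve $\mathbf{FC}$ with $(x_{K+1}^*,\tau_{K+1}^* )$; let $(u_{K+1}^*,\phi_{K+1}^*,\nu_{K+1}^*,\mu_{K+1}^*,y_{K+1}^*,s_{K+1}^* )$ be the optimal solution. If $1^\top s_{K+1}^*>0$, let $UB_{K+1}=UB_K$ and go to Step 6. Otherwise go to Step 4. 4. Solve $\mathbf{SP}$ with $(x_{K+1}^*,\tau_{K+1}^* )$; denote the optimal solution by $(u_{K+1}^*,\phi_{K+1}^*,\nu_{K+1}^*,y_{K+1}^* )$. Let $UB_{K+1}=f(x_{K+1}^* )+\sum_{i\in\mathcal I}C_{i,K+1}^*+c^\top y_{K+1}^*$. 5. If $|UB_{K+1}-LB_{K+1}|\le\epsilon$, terminate and output $(x_{K+1}^*,\tau_{K+1}^* )$. Otherwise go to Step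 6. 6. Create variables $(y^{K+1},u^{K+1})$ and add to $\mathbf{MP}$ the constraints $\zeta\ge c^\top y^{K+1}$, $Ax+By^{K+1}+Du^{K+1}\le q$, $u^{K+1}=u^e(\tau)+u^h(\tau)\phi_{K+1}^*$. Update $K=K+1$ and go to Step 2.
   Formalization: With tolerance ε > 0 the output need not be exactly optimal, so ''the optimal solution'' is proved as optimal up to ε for every ε ≥ 0 (exact at ε = 0); that the algorithm can always continue is proved assuming each master problem has an optimal solution (LB = -∞ when K = 0). *)

(* Defs.v *)
From HB Require Import structures.
From mathcomp Require Import all_boot all_order all_algebra finmap.
From mathcomp Require Import boolp classical_sets functions cardinality.
From mathcomp Require Import reals constructive_ereal ereal.

Set Implicit Arguments.
Unset Strict Implicit.
Unset Printing Implicit Defensive.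

Import Order.TTheory GRing.Theory Num.Theory.

Local Open Scope classical_set_scope.
Local Open Scope ring_scope.

Definition lev (R : realType) (m : nat) (v w : 'cV[R]_m) : Prop :=
  forall k, v k 0 <= w k 0.

(* [complementary v w] is the constraint 0 <= v _|_ w >= 0. *)
Definition complementary (R : realType) (m : nat) (v w : 'cV[R]_m) : Prop :=
  [/\ lev 0 v, lev 0 w & forall k, v k 0 * w k 0 = 0].

Definition coord_sum (R : realType) (m : nat) (s : 'cV[R]_m) : R :=
  \sum_k s k 0.

Definition vertices (R : realType) (m n : nat) (S : set 'M[R]_(m, n)) :
    set 'M[R]_(m, n) :=
  [set v | S v /\ forall (a b : 'M[R]_(m, n)) (t : R), S a -> S b ->
     0 < t < 1 -> v = t *: a + (1 - t) *: b -> a = b].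

(* nI agents, nT periods; nx and ny are the dimensions of the two decision
   stages and m is the number of second-stage constraints. A family indexed by
   (i, t) is an nI x nT matrix, flattened by [mxvec] where D acts on it. *)
Record problem (R : realType) (nI nT nx ny m : nat) := Problem {
  delta : R;
  xi : R;
  mhat : R;
  sigma2U : 'I_nI -> R;
  ubar : 'M[R]_(nI, nT);
  upre : 'M[R]_(nI, nT);
  Xset : set 'cV[R]_nx;
  fcost : 'cV[R]_nx -> R;
  Amx : 'M[R]_(m, nx);
  Bmx : 'M[R]_(m, ny);
  Dmx : 'M[R]_(m, nI * nT);
  qvec : 'cV[R]_m;
  cvec : 'cV[R]_ny
}.

Record plan (R : realType) (nI nx : nat) := Plan {
  pl_x : 'cV[R]_nx;
  pl_C : 'I_nI -> R;
  pl_tau : 'I_nI -> R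
}.

(* K is the number of stored scenarios. The epigraph variable zeta ranges over
   the extended reals: with K = 0 it is unconstrained, so that the optimal value
   is -oo, attained exactly at zeta = -oo with any feasible (x, C, tau); with
   K > 0 the constraints zeta >= c^T y^k exclude -oo. *)
Record mp_var (R : realType) (nI nT nx ny K : nat) := MPVar {
  mp_plan : plan R nI nx;
  mp_zeta : \bar R;
  mp_y : 'I_K -> 'cV[R]_ny;
  mp_u : 'I_K -> 'M[R]_(nI, nT)
}.

Record fc_var (R : realType) (nI nT ny m : nat) := FCVar {
  fc_u : 'M[R]_(nI, nT);
  fc_phi : 'M[R]_(nI, nT);
  fc_nu : 'cV[R]_m;
  fc_mu : 'cV[R]_m;
  fc_y : 'cV[R]_ny;
  fc_s : 'cV[R]_m
}.

Record sp_var (R : realType) (nI nT ny m : nat) := SPVar {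
  sp_u : 'M[R]_(nI, nT);
  sp_phi : 'M[R]_(nI, nT);
  sp_nu : 'cV[R]_m;
  sp_y : 'cV[R]_ny
}.

(* [Running phis UB] : about to solve the master problem with K = size phis
   stored vertices; [Stopped p] : terminated, p being the last master plan. *)
Inductive status (R : realType) (nI nT nx : nat) :=
| Running (phis : seq 'M[R]_(nI, nT)) (UB : \bar R)
| Stopped (p : plan R nI nx).

Arguments Running {R nI nT nx}.
Arguments Stopped {R nI nT nx}.

Section Definitions.
Context (R : realType) (nI nT nx ny m : nat) (P : problem R nI nT nx ny m).

Implicit Types (x : 'cV[R]_nx) (tau : 'I_nI -> R) (u phi : 'M[R]_(nI, nT)).
Implicit Types (y : 'cV[R]_ny) (p : plan R nI nx).

Definition second_cost (y : 'cV[R]_ny) : R := ((cvec P)^T *m y) 0 0.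

Definition lhs (x : 'cV[R]_nx) (y : 'cV[R]_ny) (u : 'M[R]_(nI, nT)) :
    'cV[R]_m :=
  Amx P *m x + Bmx P *m y + Dmx P *m (mxvec u)^T.

Definition Yset x u : set 'cV[R]_ny := [set y | lev (lhs x y u) (qvec P)].

(* The cost is +oo at tau_i = 1, where the formula has a zero denominator (and
   x / 0 = 0 would make a perfect prediction free). *)
Definition pred_cost (i : 'I_nI) (t : R) : \bar R :=
  if t == 1 then +oo%E else (mhat P / sigma2U P i * (t / (1 - t)))%:E.

Definition uexp tau : 'M[R]_(nI, nT) :=
  \matrix_(i, t) ((1 - tau i) * ubar P i t + tau i * upre P i t).

(* sigma_eps_i^2, obtained by solving
   tau_i = sigma_U_i^2 / (sigma_U_i^2 + sigma_eps_i^2). At tau_i = 0 the value is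
   immaterial: it only occurs multiplied by tau_i^2. *)
Definition sigma2eps tau (i : 'I_nI) : R :=
  sigma2U P i * (1 - tau i) / tau i.

Definition uhalf tau (i : 'I_nI) : R :=
  Num.sqrt (((1 - tau i) ^+ 2 * sigma2U P i + tau i ^+ 2 * sigma2eps tau i)
            / (1 - delta P)).

Definition gammaS : R :=
  Num.sqrt (nI%:R * (1 - delta P) * (1 + nI%:R - nI%:R * xi P) / (1 - xi P)).

Definition gammaT : R :=
  Num.sqrt (nT%:R * (1 - delta P) * (1 + nT%:R - nT%:R * xi P) / (1 - xi P)).

Definition Phi : set 'M[R]_(nI, nT) :=
  [set phi | exists psi : 'M[R]_(nI, nT),
    [/\ forall i t, -1 <= phi i t <= 1,
        forall i t, phi i t <= psi i t /\ - phi i t <= psi i t,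
        forall t, \sum_i psi i t <= gammaS
      & forall i, \sum_t psi i t <= gammaT]].

Definition scen tau phi : 'M[R]_(nI, nT) :=
  uexp tau + \matrix_(i, t) (uhalf tau i * phi i t).

Definition Uset tau : set 'M[R]_(nI, nT) :=
  [set u | exists2 phi, Phi phi & u = scen tau phi].

Definition XR tau : set 'cV[R]_nx :=
  [set x | forall u, Uset tau u -> Yset x u !=set0].

Definition first_cost p : R := fcost P (pl_x p) + \sum_i pl_C p i.

Definition tau_ok p : Prop :=
  forall i, (pred_cost i (pl_tau p i) <= (pl_C p i)%:E)%E /\
            0 <= pl_tau p i <= 1.

Definition ddu_feasible p : Prop :=
  (Xset P `&` XR (pl_tau p)) (pl_x p) /\ tau_ok p.

Definition ddu_objective p : \bar R :=
  ((first_cost p)%:E +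
   ereal_sup [set ereal_inf [set (second_cost y)%:E | y in Yset (pl_x p) u]
             | u in Uset (pl_tau p)])%E.

(* Optimality up to an additive tolerance; eps = 0 is exact optimality. *)
Definition ddu_optimal (eps : R) p : Prop :=
  ddu_feasible p /\
  forall p', ddu_feasible p' ->
    (ddu_objective p <= ddu_objective p' + eps%:E)%E.

Definition mp_feasible (phis : seq 'M[R]_(nI, nT))
    (w : mp_var R nI nT nx ny (size phis)) : Prop :=
  let p := mp_plan w in
  [/\ Xset P (pl_x p), tau_ok p &
      forall k : 'I_(size phis),
        [/\ ((second_cost (mp_y w k))%:E <= mp_zeta w)%E,
            lev (lhs (pl_x p) (mp_y w k) (mp_u w k)) (qvec P)
          & mp_u w k = scen (pl_tau p) phis`_k]].

Definition mp_objective K (w : mp_var R nI nT nx ny K) : \bar R :=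
  ((first_cost (mp_plan w))%:E + mp_zeta w)%E.

Definition mp_optimal (phis : seq 'M[R]_(nI, nT))
    (w : mp_var R nI nT nx ny (size phis)) : Prop :=
  mp_feasible w /\
  forall w', mp_feasible (phis := phis) w' ->
    (mp_objective w <= mp_objective w')%E.

Definition fc_feasible x tau (v : fc_var R nI nT ny m) : Prop :=
  [/\ Phi (fc_phi v) /\ fc_u v = scen tau (fc_phi v),
      (Bmx P)^T *m fc_nu v = 0,
      - fc_nu v + fc_mu v = const_mx 1,
      complementary (- fc_nu v) (- (lhs x (fc_y v) (fc_u v) - fc_s v) + qvec P)
    & complementary (fc_mu v) (fc_s v)].

(* Among the optimal solutions only those at a vertex of Phi are retained; the
   same holds for [sp_optimal]. *)
Definition fc_optimal x tau (v : fc_var R nI nT ny m) : Prop :=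
  [/\ fc_feasible x tau v, vertices Phi (fc_phi v) &
      forall v', fc_feasible x tau v' -> coord_sum (fc_s v') <= coord_sum (fc_s v)].

Definition sp_feasible x tau (v : sp_var R nI nT ny m) : Prop :=
  [/\ Phi (sp_phi v) /\ sp_u v = scen tau (sp_phi v),
      (Bmx P)^T *m sp_nu v = cvec P
    & complementary (- sp_nu v) (- lhs x (sp_y v) (sp_u v) + qvec P)].

Definition sp_optimal x tau (v : sp_var R nI nT ny m) : Prop :=
  [/\ sp_feasible x tau v, vertices Phi (sp_phi v) &
      forall v', sp_feasible x tau v' ->
        second_cost (sp_y v') <= second_cost (sp_y v)].

(* MP, FC and SP may return any of their optimal solutions. The first
   feasible plan is arbitrary, since zeta = -oo makes them all optimal. *)
Inductive iteration (eps : R) : status R nI nT nx -> status R nI nT nx -> Prop :=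
| iter_feasibility_cut phis UB (w : mp_var R nI nT nx ny (size phis)) v :
    mp_optimal w ->
    fc_optimal (pl_x (mp_plan w)) (pl_tau (mp_plan w)) v ->
    0 < coord_sum (fc_s v) ->
    iteration eps (Running phis UB) (Running (rcons phis (fc_phi v)) UB)
| iter_optimality_cut phis UB (w : mp_var R nI nT nx ny (size phis)) v z :
    mp_optimal w ->
    fc_optimal (pl_x (mp_plan w)) (pl_tau (mp_plan w)) v ->
    ~ 0 < coord_sum (fc_s v) ->
    sp_optimal (pl_x (mp_plan w)) (pl_tau (mp_plan w)) z ->
    let LB := mp_objective w in
    let UB' := (first_cost (mp_plan w) + second_cost (sp_y z))%:E in
    ~ (`|UB' - LB| <= eps%:E)%E ->
    iteration eps (Running phis UB) (Running (rcons phis (sp_phi z)) UB')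
| iter_stop phis UB (w : mp_var R nI nT nx ny (size phis)) v z :
    mp_optimal w ->
    fc_optimal (pl_x (mp_plan w)) (pl_tau (mp_plan w)) v ->
    ~ 0 < coord_sum (fc_s v) ->
    sp_optimal (pl_x (mp_plan w)) (pl_tau (mp_plan w)) z ->
    let LB := mp_objective w in
    let UB' := (first_cost (mp_plan w) + second_cost (sp_y z))%:E in
    (`|UB' - LB| <= eps%:E)%E ->
    iteration eps (Running phis UB) (Stopped (mp_plan w)).

(* [run eps n s] : some execution is in status s after exactly n iterations. *)
Inductive run (eps : R) : nat -> status R nI nT nx -> Prop :=
| run_init : run eps 0 (Running [::] +oo%E)
| run_step n s s' : run eps n s -> iteration eps s s' -> run eps n.+1 s'.

(* For nonempty phis this also rules out a second stage unbounded below, hence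
   it covers the solvability of SP as well. *)
Definition mp_solvable : Prop :=
  forall phis : seq 'M[R]_(nI, nT),
    (forall phi, phi \in phis -> vertices Phi phi) ->
    exists w : mp_var R nI nT nx ny (size phis), mp_optimal w.

Definition nU : nat := #|` fset_set (vertices Phi)|%fset.

Lemma sigma2epsE tau i : sigma2U P i != 0 -> tau i != 0 ->
  tau i = sigma2U P i / (sigma2U P i + sigma2eps tau i).
Proof.
move=> s0 t0; rewrite /sigma2eps.
have -> : sigma2U P i + sigma2U P i * (1 - tau i) / tau i = sigma2U P i / tau i.
  apply: (mulIf t0); rewrite mulrDl !mulfVK // -mulrDr addrC subrK mulr1 //.
by rewrite invf_div mulrCA divff // mulr1.
Qed.

Lemma uhalfE tau i :
  uhalf tau i = Num.sqrt ((1 - tau i) * sigma2U P i / (1 - delta P)).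
Proof.
rewrite /uhalf /sigma2eps; congr (Num.sqrt (_ / _)).
have [->|t0] := eqVneq (tau i) 0.
  by rewrite expr0n /= mul0r addr0 subr0 expr1n.
have -> : tau i ^+ 2 * (sigma2U P i * (1 - tau i) / tau i) =
          tau i * (1 - tau i) * sigma2U P i.
  rewrite expr2 -mulrA mulrCA [tau i * (_ / _)]mulrC mulfVK //.
  by rewrite mulrC [sigma2U P i * _]mulrC mulrAC [(1 - _) * _]mulrC.
by rewrite expr2 -mulrDl -mulrDl subrK mul1r.
Qed.

End Definitions.

(* Main.v *)
From HB Require Import structures.
Require Import Defs.
From mathcomp Require Import all_boot all_order all_algebra finmap.
From mathcomp Require Import boolp classical_sets functions cardinality.
From mathcomp Require Import reals constructive_ereal ereal.
From mathcomp Require Import ring lra.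

(** Termination. No iteration stores a vertex of Phi that is already stored.
    The master plan comes with a second-stage decision for every stored vertex.
    If the feasibility check returned a stored vertex, that decision would give
    its inner program the value 0, and weak duality would force the optimum of
    the check to be at most 0 ([fc_cut_new]). If the sub-problem returned a
    stored vertex, weak duality would bound its value by zeta, hence UB <= LB;
    as LB <= UB always holds, the gap would be 0 and the algorithm would stop
    ([sp_cut_new]). Since Phi is a polytope, it has finitely many vertices, and
    a run of n iterations that has not stopped has stored n distinct ones. So a
    run has at most nU + 1 iterations, and nU >= 1 makes this at most 2 nU.

    Correctness. The master problem is a relaxation of the robust problem
    ([mp_le_ddu]): given a robust feasible plan and a real number r above its
    worst-case cost, every stored scenario admits a decision of cost below r.
    When the feasibility check is nonpositive, strong duality shows that the
    master plan is robust feasible ([fc_nonpositive]) and that its robust value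
    is at most UB ([ddu_le_sp]). At termination UB <= LB + eps, so the plan is
    optimal up to eps.

    Progress. The complementarity systems FC and SP must have optimal solutions
    at vertices of Phi. At a fixed scenario they are the optimality conditions
    of a linear program, so strong duality with attainment ([lp_kkt]) solves
    them. With the multiplier nu fixed, the dual objective is affine in phi and
    by weak duality bounds from below the value at any scenario. An affine
    function on Phi is dominated at some vertex, so the best solution over the
    finitely many vertices is optimal ([best_vertex]). For SP the dual must be
    feasible as well: otherwise a ray of the second stage would improve an
    optimal solution of the master problem with one stored vertex
    ([dual_feasible_of_solvable]).

    The linear programming theory rests on two facts about the solution set of
    finitely many linear inequalities: the Farkas lemma ([farkas]), and the
    possibility of walking from any point to a corner without decreasing a
    given linear objective ([climb]). A corner is determined, as far as the
    objective is concerned, by the set of its tight constraints, and there are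
    finitely many such sets. This yields the finiteness of the vertex set, the
    domination by vertices, and the existence of optima; at an optimum, the
    Farkas lemma for the tight constraints provides the multipliers ([kkt]). *)

Set Implicit Arguments.
Unset Strict Implicit.
Unset Printing Implicit Defensive.

Import Order.TTheory GRing.Theory Num.Theory.
Local Open Scope classical_set_scope.
Local Open Scope ring_scope.

(** * Frobenius inner product and the Farkas lemma *)

Section Dot.
Context (R : realType).

(** The Frobenius inner product. Linear forms are represented by matrices
    throughout, so that combinations of forms are again plain matrices. *)
Definition dot p q (a v : 'M[R]_(p, q)) : R := \tr (a^T *m v).

Lemma dotDl p q (a b v : 'M_(p, q)) : dot (a + b) v = dot a v + dot b v.
Proof. by rewrite /dot linearD mulmxDl mxtraceD. Qed.

Lemma dotZl p q c (a v : 'M_(p, q)) : dot (c *: a) v = c * dot a v.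
Proof. by rewrite /dot linearZ -scalemxAl mxtraceZ. Qed.

Lemma dotNl p q (a v : 'M_(p, q)) : dot (- a) v = - dot a v.
Proof. by rewrite -scaleN1r dotZl mulN1r. Qed.

Lemma dotBl p q (a b v : 'M_(p, q)) : dot (a - b) v = dot a v - dot b v.
Proof. by rewrite dotDl dotNl. Qed.

Lemma dotC p q (a v : 'M_(p, q)) : dot a v = dot v a.
Proof. by rewrite /dot -mxtrace_tr trmx_mul trmxK. Qed.

Lemma dotDr p q (a v w : 'M_(p, q)) : dot a (v + w) = dot a v + dot a w.
Proof. by rewrite !(dotC a) dotDl. Qed.

Lemma dotZr p q c (a v : 'M_(p, q)) : dot a (c *: v) = c * dot a v.
Proof. by rewrite !(dotC a) dotZl. Qed.

Lemma dotNr p q (a v : 'M_(p, q)) : dot a (- v) = - dot a v.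
Proof. by rewrite !(dotC a) dotNl. Qed.

Lemma dotBr p q (a v w : 'M_(p, q)) : dot a (v - w) = dot a v - dot a w.
Proof. by rewrite !(dotC a) dotBl. Qed.

Lemma dot0r p q (a : 'M_(p, q)) : dot a 0 = 0.
Proof. by rewrite /dot mulmx0 mxtrace0. Qed.

Lemma dotE p q (a v : 'M_(p, q)) : dot a v = \sum_i \sum_j a i j * v i j.
Proof.
rewrite /dot /mxtrace exchange_big /=; apply: eq_bigr => j _.
by rewrite mxE; apply: eq_bigr => i _; rewrite mxE.
Qed.

Lemma dot_delta p q (a : 'M_(p, q)) i j : dot a (delta_mx i j) = a i j.
Proof.
rewrite dotE (bigD1 i) //= (bigD1 j) //= !mxE !eqxx mulr1 !big1 ?addr0 //.
  by move=> k ki; rewrite big1 // => l _; rewrite mxE (negPf ki) mulr0.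
by move=> l lj; rewrite mxE (negPf lj) andbF mulr0.
Qed.

Lemma dot_row m n (M : 'M_(m, n)) (y : 'cV_n) j :
  dot (row j M)^T y = (M *m y) j 0.
Proof. by rewrite /dot trmxK -row_mul [LHS]big_ord1 !mxE. Qed.

Lemma dot_mulmx m n (M : 'M_(m, n)) (y : 'cV_n) (z : 'cV_m) :
  dot (M *m y) z = dot y (M^T *m z).
Proof. by rewrite /dot trmx_mul mulmxA. Qed.

Lemma dot_col n (a v : 'cV_n) : dot a v = \sum_k a k 0 * v k 0.
Proof. by rewrite dotE; apply: eq_bigr => k _; rewrite big_ord1. Qed.

Lemma dot_ge0 n (a v : 'cV_n) : lev 0 a -> lev 0 v -> 0 <= dot a v.
Proof.
move=> a0 v0; rewrite dot_col sumr_ge0 // => k _.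
by have := a0 k; have := v0 k; rewrite !mxE => ? ?; rewrite mulr_ge0.
Qed.

Lemma scalar_dot p q (f : {scalar 'M[R]_(p, q)}) :
  exists G, forall v, f v = dot G v.
Proof.
exists (\matrix_(i, j) f (delta_mx i j)) => v.
rewrite [in LHS](matrix_sum_delta v) linear_sum dotE; apply: eq_bigr => i _.
rewrite linear_sum; apply: eq_bigr => j _.
by rewrite linearZ mxE mulrC.
Qed.

(** Induction on the number of forms. Set one form [a k] aside. If [b] is already
    implied by the others, give [a k] the weight 0. Otherwise some [x1] satisfies
    the others and violates [b], hence violates [a k], and can be scaled so that
    [a k] is 1 at it. Projecting along [x1] onto the kernel of [a k] turns the
    system into one without [a k]; the weight of [a k] is then what remains of
    [b] at [x1], which is positive since the others are nonpositive there. *)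
Lemma farkas p q (J : finType) (T : {set J}) (a : J -> 'M[R]_(p, q)) b :
  (forall x, (forall j, j \in T -> dot (a j) x <= 0) -> dot b x <= 0) ->
  exists2 z : J -> R, (forall j, 0 <= z j) & b = \sum_(j in T) z j *: a j.
Proof.
move: {2}#|T| (erefl #|T|) => n; elim: n T a b => [|n IHn] T a b cT Hb.
  have {cT} T0 j : (j \in T) = false.
    by move/eqP: cT; rewrite cards_eq0 => /eqP ->; rewrite inE.
  exists (fun=> 0) => //; rewrite big_pred0 //.
  apply/matrixP => i k; rewrite mxE; apply/le_anti/andP; split.
    by rewrite -dot_delta Hb // => j; rewrite T0.
  by rewrite -oppr_le0 -dot_delta -dotNr Hb // => j; rewrite T0.
have /card_gt0P[k kT] : (0 < #|T|)%N by rewrite cT.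
have cT' : #|(T :\ k)%SET| = n by apply/eqP; rewrite -eqSS -cT (cardsD1 k T) kT.
have [Hb'|] := pselect (forall x,
    (forall j, j \in (T :\ k)%SET -> dot (a j) x <= 0) -> dot b x <= 0).
  have [z z0 bE] := IHn _ a b cT' Hb'.
  exists (fun j => if j == k then 0 else z j) => [j|].
    by case: eqP.
  rewrite (big_setD1 k) //= eqxx scale0r add0r bE; apply: eq_bigr => j.
  by rewrite !inE => /andP[/negPf ->].
move=> /existsNP[x0 /not_implyP[ax0 /negP]]; rewrite -ltNge => bx0.
have akx0 : 0 < dot (a k) x0.
  rewrite ltNge; apply/negP => akx0; move: bx0; apply/negP; rewrite -leNgt.
  apply: Hb => j jT; have [->//|jk] := eqVneq j k.
  by apply: ax0; rewrite !inE jk.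
set x1 := (dot (a k) x0)^-1 *: x0.
have akx1 : dot (a k) x1 = 1 by rewrite dotZr mulVf ?gt_eqF.
have bx1 : 0 < dot b x1 by rewrite dotZr mulr_gt0 ?invr_gt0.
have ax1 j : j \in (T :\ k)%SET -> dot (a j) x1 <= 0.
  by move=> jT; rewrite dotZr mulr_ge0_le0 ?invr_ge0 ?(ltW akx0) ?ax0.
have [|z z0 bE] := IHn _ (fun j => a j - dot (a j) x1 *: a k)
    (b - dot b x1 *: a k) cT'.
  (* Apply the hypothesis to the projection [x - dot (a k) x *: x1]. *)
  move=> x ax; rewrite dotBl dotZl mulrC -dotZr -dotBr; apply: Hb => j jT.
  rewrite dotBr dotZr; have [->|jk] := eqVneq j k.
    by rewrite akx1 mulr1 subrr.
  by rewrite mulrC -dotZl -dotBl ax // !inE jk.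
exists (fun j => if j == k
    then dot b x1 - \sum_(i in (T :\ k)%SET) z i * dot (a i) x1 else z j).
  move=> j; case: eqP => // _; rewrite subr_ge0 (le_trans _ (ltW bx1)) //.
  by apply: sumr_le0 => i iT; rewrite mulr_ge0_le0 ?ax1.
rewrite (big_setD1 k) //= eqxx.
rewrite [X in _ + X](eq_bigr (fun j => z j *: a j)); last first.
  by move=> j; rewrite !inE => /andP[/negPf ->].
move/eqP: bE; rewrite subr_eq => /eqP {1}->.
under [X in X + _ = _]eq_bigr do rewrite scalerBr scalerA.
rewrite sumrB scalerBl -scaler_suml.
by rewrite [RHS]addrC addrA addrAC.
Qed.

End Dot.

(** * Polyhedra and their corners *)

Lemma max_of_finite (R : realType) (T : eqType) (A : set T) (F : T -> R) :
  finite_set A -> A !=set0 -> exists2 x, A x & forall y, A y -> F y <= F x.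
Proof.
move=> /finite_seqP[s ->] [x0 x0s].
elim: s x0 x0s => [//|y s IHs] _ _; case: s IHs => [_|z s IHs].
  by exists y; rewrite /= ?mem_head // => w; rewrite inE => /eqP ->.
have [|x xs xmax] := IHs z; first exact: mem_head.
have [xy|yx] := leP (F x) (F y).
  exists y => [|w] /=; first exact: mem_head.
  by rewrite inE => /predU1P[->//|/xmax wx]; exact: le_trans xy.
exists x => [|w] /=; first by rewrite inE [x \in _]xs orbT.
by rewrite inE => /predU1P[->|/xmax//]; exact: ltW.
Qed.

Section Polyhedra.
Context (R : realType) (p q : nat) (J : finType).
Implicit Types (a : J -> 'M[R]_(p, q)) (h : J -> R) (v w d L : 'M[R]_(p, q)).

Definition polyhedron a h : set 'M[R]_(p, q) :=
  [set v | forall j, dot (a j) v <= h j].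

Definition tight a h v : {set J} := [set j | dot (a j) v == h j]%SET.

(** Only the tight constraints restrict the directions in which one can move. *)
Lemma small_step a h v d : polyhedron a h v ->
  (forall j, j \in tight a h v -> dot (a j) d <= 0) ->
  exists2 e : R, 0 < e & polyhedron a h (v + e *: d).
Proof.
move=> Sv Td.
pose e := \big[Num.min/1]_(j | 0 < dot (a j) d)
  ((h j - dot (a j) v) / dot (a j) d).
have e0 : 0 < e.
  apply: lt_bigmin => // j jd; rewrite divr_gt0 // subr_gt0 lt_neqAle Sv.
  rewrite andbT; apply/negP => jT; have := Td j; rewrite inE => /(_ jT).
  by rewrite leNgt jd.
exists e => // j.
rewrite dotDr dotZr; have [jd|jd] := ltP 0 (dot (a j) d).
  rewrite addrC -lerBrDr -ler_pdivlMr //; exact: bigmin_le_cond.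
by rewrite (le_trans _ (Sv j)) // gerDl mulr_ge0_le0 // ltW.
Qed.

(** The ratio test of the simplex method: moving until the first constraint
    blocks keeps the tight constraints tight and adds one. *)
Lemma step_to_tight a h v d j0 : polyhedron a h v -> 0 < dot (a j0) d ->
  (forall j, j \in tight a h v -> dot (a j) d = 0) ->
  exists e : R, [/\ 0 <= e, polyhedron a h (v + e *: d) &
    (tight a h v \proper tight a h (v + e *: d))%SET].
Proof.
move=> Sv j0d Td.
pose r j := (h j - dot (a j) v) / dot (a j) d.
have [k kd kmin] := @arg_minP _ _ _ j0 (fun j => 0 < dot (a j) d) r j0d.
have rk0 : 0 <= r k by rewrite divr_ge0 ?subr_ge0 // ltW.
exists (r k); split=> //.
  move=> j; rewrite dotDr dotZr; have [jd|jd] := ltP 0 (dot (a j) d).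
    rewrite addrC -lerBrDr -ler_pdivlMr //; exact: kmin.
  by rewrite (le_trans _ (Sv j)) // gerDl mulr_ge0_le0.
apply/properP; split.
  apply/fintype.subsetP => j jT; rewrite inE dotDr dotZr Td // mulr0 addr0.
  by move: jT; rewrite inE.
exists k.
  by rewrite inE dotDr dotZr /r (divfK (lt0r_neq0 kd)) addrC subrK.
by apply/negP => /Td kd0; move: kd; rewrite kd0 ltxx.
Qed.

(** The notion of corner that remains available when the polyhedron contains
    lines: the tight constraints fix the value of [L] and of all constraints, so
    that moving along their common kernel changes nothing. If only [d = 0] is
    annihilated by all forms, a cornered point of the polyhedron is a vertex. *)
Definition cornered L a h w := forall d,
  (forall j, j \in tight a h w -> dot (a j) d = 0) ->
  dot L d = 0 /\ forall j, dot (a j) d = 0.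

(** While the point is not cornered, some direction annihilates the tight forms
    and can be signed so that [L] does not decrease along it. It must run into
    a constraint: if it increases [L], because [L] increases along no ray;
    if [L] is constant, because some form changes along it and its sign is
    free. Each move makes one more constraint tight. *)
Lemma climb L a h v : polyhedron a h v ->
  (forall d, (forall j, dot (a j) d <= 0) -> dot L d <= 0) ->
  exists w, [/\ polyhedron a h w, dot L v <= dot L w & cornered L a h w].
Proof.
move=> + Lrec; move: {2}#|_|.+1 (ltnSn #|~: tight a h v|%SET) => n.
elim: n v => [//|n IHn] v cv Sv.
have [cor|/existsNP[d /not_implyP[Td dN]]] := pselect (cornered L a h v).
  by exists v.
have [d' [Td' Ld' [j jd']]] : exists d',
    [/\ forall j, j \in tight a h v -> dot (a j) d' = 0,
        0 <= dot L d' & exists j, 0 < dot (a j) d'].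
  have TNd j : j \in tight a h v -> dot (a j) (- d) = 0.
    by move=> /Td jd; rewrite dotNr jd oppr0.
  have pos d' : 0 < dot L d' -> exists j, 0 < dot (a j) d'.
    move=> Ld'; apply/not_existsP => jN; move: Ld'; rewrite ltNge => /negP; apply.
    by apply: Lrec => j; rewrite leNgt; apply/negP/jN.
  case: (ltgtP (dot L d) 0) => [Ld|Ld|Ld].
  - by exists (- d); split=> //; [|apply: pos]; rewrite dotNr ?oppr_ge0 ?oppr_gt0 // ltW.
  - by exists d; split=> //; [rewrite ltW|apply: pos].
  - have /existsNP[j /eqP jd] : ~ forall j, dot (a j) d = 0 by move=> ad; exact: dN.
    have [jd0|jd0|jd0] := ltgtP (dot (a j) d) 0.
    + exists (- d); split=> //; first by rewrite dotNr Ld oppr0.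
      by exists j; rewrite dotNr oppr_gt0.
    + by exists d; split=> //; [rewrite Ld|exists j].
    + by rewrite jd0 eqxx in jd.
have [e [e0 Se Te]] := step_to_tight Sv jd' Td'.
have [|w [Sw Lw cw]] := IHn (v + e *: d') _ Se.
  by rewrite -ltnS (leq_trans _ cv) // ltnS proper_card // finset.properC.
exists w; split=> //; apply: le_trans Lw.
by rewrite dotDr dotZr lerDl mulr_ge0.
Qed.

(** Two cornered points with the same tight set have the same value of [L], so
    only finitely many values compete. This replaces compactness, which an
    unbounded polyhedron lacks. *)
Lemma max_attained L a h v : polyhedron a h v ->
  (forall d, (forall j, dot (a j) d <= 0) -> dot L d <= 0) ->
  exists2 w, polyhedron a h w & forall w', polyhedron a h w' -> dot L w' <= dot L w.
Proof.
move=> Sv Lrec.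
pose good w T := [/\ polyhedron a h w, cornered L a h w & tight a h w = T].
have /boolp.choice[W WP] : forall T, exists w, (exists w', good w' T) -> good w T.
  by move=> T; have [[w gw]|Tn] := pselect (exists w, good w T); [exists w|exists v].
have [||T AT Tmax] := @max_of_finite _ _ [set T | exists w, good w T]
    (fun T => dot L (W T)).
- exact: finite_finset.
- by have [w [? _ ?]] := climb Sv Lrec; exists (tight a h w), w.
exists (W T) => [|w' Sw']; first by case: (WP _ AT).
have [w [Sw Lw cw]] := climb Sw' Lrec.
have gw : exists w0, good w0 (tight a h w) by exists w.
apply: le_trans Lw (le_trans _ (Tmax _ gw)).
have [_ _ tw] := WP _ gw.
have [|+ _] := cw (w - W (tight a h w)).
  move=> j jT; have: j \in tight a h (W (tight a h w)) by rewrite tw.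
  by move: jT; rewrite !inE dotBr => /eqP -> /eqP ->; rewrite subrr.
by rewrite dotBr => /eqP; rewrite subr_eq0 => /eqP ->.
Qed.

(** At a maximizer, no direction that respects the tight constraints increases
    [L]; the Farkas lemma for the tight forms alone gives complementary
    multipliers. *)
Lemma kkt L a h v : polyhedron a h v ->
  (forall d, (forall j, dot (a j) d <= 0) -> dot L d <= 0) ->
  exists w (z : J -> R), [/\ polyhedron a h w, forall j, 0 <= z j,
    L = \sum_j z j *: a j & forall j, z j * (h j - dot (a j) w) = 0].
Proof.
move=> Sv Lrec; have [w Sw wmax] := max_attained Sv Lrec.
have [|z z0 LE] := @farkas _ _ _ _ (tight a h w) a L.
  move=> d Td; have [e e0 Se] := small_step Sw Td.
  by have := wmax _ Se; rewrite dotDr dotZr gerDl pmulr_rle0.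
exists w, (fun j => if j \in tight a h w then z j else 0); split=> //.
- by move=> j; case: ifP.
- rewrite LE big_mkcond; apply: eq_bigr => j _.
  by case: ifP; rewrite ?scale0r.
- move=> j; rewrite inE; case: eqP => [->|_]; first by rewrite subrr mulr0.
  by rewrite mul0r.
Qed.

End Polyhedra.

Section Polytopes.
Context (R : realType) (p q : nat) (J : finType).
Context (a : J -> 'M[R]_(p, q)) (h : J -> R).

(** Otherwise one could move both ways along [d], and [v] would lie inside a
    segment. Hence a vertex is determined by its tight set. *)
Lemma vertex_tight v d : vertices (polyhedron a h) v ->
  (forall j, j \in tight a h v -> dot (a j) d = 0) -> d = 0.
Proof.
move=> [Sv ext] Td.
have [|e e0 Se] := small_step Sv (d := d); first by move=> j /Td ->.
have [|e' e'0 Se'] := small_step Sv (d := - d).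
  by move=> j /Td jd; rewrite dotNr jd oppr0.
have e1 : 0 < e + e' by rewrite addr_gt0.
have E : v + e *: d = v + e' *: - d.
  apply: (ext _ _ (e' / (e + e'))) => //.
    by rewrite divr_gt0 //= ltr_pdivrMr // mul1r ltrDr.
  apply/matrixP => i j; rewrite !mxE; field; exact: lt0r_neq0.
move: E => /addrI /eqP; rewrite scalerN -subr_eq0 opprK -scalerDl.
by rewrite scaler_eq0 gt_eqF //= => /eqP.
Qed.

Lemma finite_vertices : finite_set (vertices (polyhedron a h)).
Proof.
rewrite -(eq_finite_set (inj_card_eq (f := tight a h) _)).
  exact: finite_finset.
move=> v w /set_mem Vv /set_mem [Sw _] vw; apply/eqP; rewrite -subr_eq0; apply/eqP.
apply: (vertex_tight Vv) => j jT; have: j \in tight a h w by rewrite -vw.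
by move: jT; rewrite !inE dotBr => /eqP -> /eqP ->; rewrite subrr.
Qed.

Lemma vertex_of_tight v : polyhedron a h v ->
  (forall d, (forall j, j \in tight a h v -> dot (a j) d = 0) -> d = 0) ->
  vertices (polyhedron a h) v.
Proof.
move=> Sv Td; split=> // b c t Sb Sc /andP[t0 t1] vE.
apply/eqP; rewrite -subr_eq0; apply/eqP/Td => j; rewrite inE vE.
rewrite dotDr !dotZr dotBr => /eqP E.
have {t1} : 0 < 1 - t by rewrite subr_gt0.
have := Sb j; have := Sc j; move: E t0.
move: (dot _ b) (dot _ c) (h j) => x y k E t0 yk xk t1.
have x1 : t * (k - x) = 0 by nra.
have y1 : (1 - t) * (k - y) = 0 by nra.
move/eqP: x1; rewrite mulf_eq0 (gt_eqF t0) subr_eq0 /= => /eqP <-.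
by move/eqP: y1; rewrite mulf_eq0 (gt_eqF t1) subr_eq0 /= => /eqP <-; rewrite subrr.
Qed.

Lemma vertex_above L v : (forall d, (forall j, dot (a j) d <= 0) -> d = 0) ->
  polyhedron a h v ->
  exists2 w, vertices (polyhedron a h) w & dot L v <= dot L w.
Proof.
move=> bnd Sv; have [|w [Sw Lw cw]] := climb (L := L) Sv.
  by move=> d /bnd ->; rewrite dot0r.
exists w => //; apply: vertex_of_tight => // d /cw[_ ad].
by apply: bnd => j; rewrite ad.
Qed.

End Polytopes.

(** * Linear programming duality *)

Section LinearPrograms.
Context (R : realType).

(** Strong duality with attainment for the minimization of [dot c y] subject to
    [M *m y <= h]: a feasible dual point [nu0] shows that the objective does not
    decrease along rays. *)
Lemma lp_kkt m n (M : 'M[R]_(m, n)) (h : 'cV_m) (c : 'cV_n) y0 nu0 :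
  lev (M *m y0) h -> lev nu0 0 -> M^T *m nu0 = c ->
  exists y nu, M^T *m nu = c /\ complementary (- nu) (h - M *m y).
Proof.
move=> Sy0 nu0le nu0c.
have [||y [z [Sy z0 cE zy]]] :=
    @kkt _ _ _ _ (- c) (fun j => (row j M)^T) (fun j => h j 0) y0.
- by move=> j; rewrite dot_row.
- move=> d Md; rewrite -nu0c dotNl dotC -dot_mulmx oppr_le0.
  rewrite -[dot _ _]opprK -dotNl -dotNr dot_ge0 // => k.
    by have := Md k; rewrite dot_row !mxE oppr_ge0.
  by have := nu0le k; rewrite !mxE oppr_ge0.
exists y, (- \col_j z j); split.
  rewrite -[c]opprK cE mulmxN; congr (- _); apply/matrixP => i k.
  rewrite mxE summxE; apply: eq_bigr => j _.
  by rewrite !mxE mulrC.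
have hE k : (h - M *m y) k 0 = h k 0 - dot (row k M)^T y.
  by rewrite dot_row 2!mxE.
split=> k; rewrite ?opprK.
- by rewrite !mxE z0.
- by rewrite hE mxE subr_ge0.
- by rewrite hE mxE zy.
Qed.

Lemma dual_feasible m n (M : 'M[R]_(m, n)) (c : 'cV_n) :
  (forall d, lev (M *m d) 0 -> 0 <= dot c d) ->
  exists2 nu, lev nu 0 & M^T *m nu = c.
Proof.
move=> Hc; have [|z z0 cE] := @farkas _ _ _ _ [set: 'I_m]%SET
    (fun j => (row j M)^T) (- c).
  move=> d Md; rewrite dotNl oppr_le0; apply: Hc => k.
  by rewrite -dot_row [leRHS]mxE Md ?inE.
exists (- \col_j z j) => [k|]; first by rewrite !mxE oppr_le0.
rewrite -[c]opprK cE mulmxN; congr (- _); apply/matrixP => i k.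
rewrite mxE summxE; apply: eq_big => [j|j _]; first by rewrite inE.
by rewrite !mxE mulrC.
Qed.

End LinearPrograms.

(** * The budget set as a polytope *)

Section BudgetSet.
Context (R : realType) (nI nT nx ny m : nat) (P : problem R nI nT nx ny m).

(** [Phi] is the projection of a polyhedron in [(phi, psi)]. Its inequalities in
    [phi] alone are obtained with [psi = |phi|], each sum of absolute values being
    the largest of the signed sums over all sign patterns. *)
Definition budget_index : finType :=
  ('I_nI * 'I_nT * bool + {ffun 'I_nI -> bool} * 'I_nT +
   {ffun 'I_nT -> bool} * 'I_nI)%type.

Definition budget_form (j : budget_index) : 'M[R]_(nI, nT) :=
  match j with
  | inl (inl (i, t, b)) => (-1) ^+ b *: delta_mx i t
  | inl (inr (s, t)) => \matrix_(i, t') ((-1) ^+ s i * (t' == t)%:R)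
  | inr (s, i) => \matrix_(i', t) ((-1) ^+ s t * (i' == i)%:R)
  end.

Definition budget_bound (j : budget_index) : R :=
  match j with
  | inl (inl _) => 1
  | inl (inr _) => gammaS P
  | inr _ => gammaT P
  end.

Lemma dot_budget_box i t (b : bool) phi :
  dot (budget_form (inl (inl (i, t, b)))) phi = (-1) ^+ b * phi i t.
Proof. by rewrite /= dotZl dotC dot_delta. Qed.

Lemma dot_budget_col s t phi :
  dot (budget_form (inl (inr (s, t)))) phi = \sum_i (-1) ^+ s i * phi i t.
Proof.
rewrite dotE; apply: eq_bigr => i _; rewrite (bigD1 t) //= mxE eqxx mulr1.
by rewrite big1 ?addr0 // => t' /negPf t't; rewrite mxE t't mulr0 mul0r.
Qed.

Lemma dot_budget_row s i phi :
  dot (budget_form (inr (s, i))) phi = \sum_t (-1) ^+ s t * phi i t.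
Proof.
rewrite dotE exchange_big; apply: eq_bigr => t _; rewrite (bigD1 i) //= mxE eqxx.
by rewrite mulr1 big1 ?addr0 // => i' /negPf i'i; rewrite mxE i'i mulr0 mul0r.
Qed.

Lemma PhiE : Phi P = polyhedron budget_form budget_bound.
Proof.
have sgle (b : bool) (x y : R) : x <= y -> - x <= y -> (-1) ^+ b * x <= y.
  by case: b; rewrite ?expr1 ?expr0 ?mulN1r ?mul1r.
rewrite predeqE => phi; split=> [[psi [box abs Scol Srow]] j|Hphi].
  case: j => [[[[i t] b]|[s t]]|[s i]].
  - rewrite dot_budget_box; have /andP[? ?] := box i t.
    by apply: sgle => //=; rewrite lerNl.
  - rewrite dot_budget_col; apply: le_trans (Scol t); apply: ler_sum => i _.
    by have [? ?] := abs i t; exact: sgle.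
  - rewrite dot_budget_row; apply: le_trans (Srow i); apply: ler_sum => t _.
    by have [? ?] := abs i t; exact: sgle.
exists (\matrix_(i, t) `|phi i t|); split=> [i t|i t|t|i].
- have := Hphi (inl (inl (i, t, true))); have := Hphi (inl (inl (i, t, false))).
  by rewrite !dot_budget_box /= expr0 expr1 mulN1r mul1r lerNl => -> ->.
- by rewrite mxE ler_norm -normrN ler_norm.
- have := Hphi (inl (inr ([ffun i0 => phi i0 t < 0], t))).
  rewrite dot_budget_col /=; apply: le_trans; apply: ler_sum => i _.
  by rewrite mxE ffunE -normrEsign ?num_real.
- have := Hphi (inr ([ffun t0 => phi i t0 < 0], i)).
  rewrite dot_budget_row /=; apply: le_trans; apply: ler_sum => t _.
  by rewrite mxE ffunE -normrEsign ?num_real.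
Qed.

Lemma budget_bounded d : (forall j, dot (budget_form j) d <= 0) -> d = 0.
Proof.
move=> Hd; apply/matrixP => i t; rewrite mxE; apply/le_anti.
have := Hd (inl (inl (i, t, true))); have := Hd (inl (inl (i, t, false))).
by rewrite !dot_budget_box /= expr0 expr1 mulN1r mul1r oppr_le0 => -> ->.
Qed.

Lemma Phi_vertex_above L phi : Phi P phi ->
  exists2 v, vertices (Phi P) v & dot L phi <= dot L v.
Proof. by rewrite PhiE; apply/vertex_above/budget_bounded. Qed.

Lemma Phi_finite_vertices : finite_set (vertices (Phi P)).
Proof. by rewrite PhiE; exact: finite_vertices. Qed.

Lemma Phi_vertex : vertices (Phi P) !=set0.
Proof.
have Phi0 : Phi P 0.
  exists 0; split=> [i t|i t|t|i]; rewrite ?mxE ?oppr0 ?lexx ?lerN10 ?ler01 //.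
  - by rewrite big1 ?sqrtr_ge0 // => i _; rewrite mxE.
  - by rewrite big1 ?sqrtr_ge0 // => t _; rewrite mxE.
by have [v] := Phi_vertex_above 0 Phi0; exists v.
Qed.

End BudgetSet.

(** * Duality for the two sub-problems *)

Section Subproblems.
Context (R : realType) (nI nT nx ny m : nat) (P : problem R nI nT nx ny m).
Implicit Types (x : 'cV[R]_nx) (tau : 'I_nI -> R) (u phi : 'M[R]_(nI, nT)).
Implicit Types (y : 'cV[R]_ny) (nu s : 'cV[R]_m).

Definition residual x u := qvec P - Amx P *m x - Dmx P *m (mxvec u)^T.

(** In terms of [residual], the inner programs have the constraints
    [B y <= residual] and the dual objective [dot nu residual]. *)
Lemma lhsE x y u : qvec P - lhs P x y u = residual x u - Bmx P *m y.
Proof. by rewrite /residual /lhs !opprD !addrA addrAC. Qed.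

Lemma subv_ge0 n (v w : 'cV[R]_n) : lev 0 (w - v) <-> lev v w.
Proof. by split=> vw k; have := vw k; rewrite !mxE subr_ge0. Qed.

Lemma YsetE x y u : Yset P x u y <-> lev (Bmx P *m y) (residual x u).
Proof. by rewrite /Yset /= -subv_ge0 lhsE subv_ge0. Qed.

Lemma second_costE y : second_cost P y = dot (cvec P) y.
Proof. by rewrite /dot [RHS]big_ord1. Qed.

Lemma coord_sumE s : coord_sum s = dot (const_mx 1) s.
Proof. by rewrite dot_col; apply: eq_bigr => k _; rewrite mxE mul1r. Qed.

(** For a fixed multiplier, the dual objective depends affinely on the
    normalized scenario; this is what makes a vertex a worst case. *)
Lemma residual_affine nu x tau : exists G k, forall phi,
  dot nu (residual x (scen P tau phi)) = dot G phi + k.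
Proof.
pose f phi := - dot nu (Dmx P *m (mxvec (\matrix_(i, t) (uhalf P tau i * phi i t)))^T).
have flin : scalar f.
  move=> c u v; rewrite /f.
  have -> : \matrix_(i, t) (uhalf P tau i * (c *: u + v) i t) =
      c *: (\matrix_(i, t) (uhalf P tau i * u i t)) +
      \matrix_(i, t) (uhalf P tau i * v i t).
    by apply/matrixP => i t; rewrite !mxE; ring.
  by rewrite !linearP /= dotDr dotZr opprD mulrN.
pose F : {scalar 'M[R]_(nI, nT)} :=
  HB.pack f (GRing.isLinear.Build _ _ _ _ f flin).
have [G GE] := scalar_dot F.
exists G, (dot nu (residual x (uexp P tau))) => phi.
rewrite -GE /F /= /f /residual /scen !linearD /= addrA.
by rewrite [LHS]dotDr dotNr [LHS]addrC.
Qed.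

Lemma complementary_dot n (v w : 'cV[R]_n) : complementary v w -> dot v w = 0.
Proof. by move=> [_ _ vw]; rewrite dot_col big1. Qed.

Lemma complementary_col_mx n (v1 v2 w1 w2 : 'cV[R]_n) :
  complementary (col_mx v1 v2) (col_mx w1 w2) ->
  complementary v1 w1 /\ complementary v2 w2.
Proof.
move=> [v0 w0 vw]; split; split=> k.
- by have := v0 (lshift n k); rewrite col_mxEu !mxE.
- by have := w0 (lshift n k); rewrite col_mxEu !mxE.
- by have := vw (lshift n k); rewrite !col_mxEu.
- by have := v0 (rshift n k); rewrite col_mxEd !mxE.
- by have := w0 (rshift n k); rewrite col_mxEd !mxE.
- by have := vw (rshift n k); rewrite !col_mxEd.
Qed.

Lemma fc_value x tau v : fc_feasible P x tau v ->
  coord_sum (fc_s v) = dot (fc_nu v) (residual x (fc_u v)).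
Proof.
move=> [_ Bnu numu /complementary_dot + /complementary_dot mus].
rewrite opprB -addrA [- _ + _]addrC lhsE dotNl dotDr dotBr [dot _ (Bmx P *m _)]dotC.
rewrite dot_mulmx Bnu dot0r subr0 => /eqP; rewrite oppr_eq0 addr_eq0 => /eqP nus.
by rewrite coord_sumE -numu dotDl dotNl nus mus opprK addr0.
Qed.

(** The dual objective of a solution of FC bounds the slack needed at any other
    scenario [u], since its multiplier is dual feasible regardless of [u]. *)
Lemma fc_weak_duality x tau v u y s : fc_feasible P x tau v ->
  lev 0 s -> lev 0 (s + (qvec P - lhs P x y u)) ->
  dot (fc_nu v) (residual x u) <= coord_sum s.
Proof.
move=> [_ Bnu numu [nu0 _ _] [mu0 _ _]] s0 sf.
have := dot_ge0 nu0 sf; rewrite lhsE dotNl dotDr dotBr [dot _ (Bmx P *m _)]dotC.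
rewrite dot_mulmx Bnu dot0r subr0 coord_sumE -numu dotDl dotNl.
have := dot_ge0 mu0 s0; lra.
Qed.

(** The inner program of FC in the variables [(y, s)] always satisfies the
    hypotheses of strong duality: large slacks are feasible, and so is the dual
    point with [nu = 0] and [mu = 1]. *)
Lemma fc_solvable_at x tau phi : Phi P phi ->
  exists2 v, fc_feasible P x tau v & fc_phi v = phi.
Proof.
move=> Phiphi; set u := scen P tau phi; set h := residual x u.
pose M := block_mx (Bmx P) (-1%:M) 0 (-1%:M).
pose s0 : 'cV[R]_m := \col_k `|h k 0|.
have [||| ys [nu [+ +]]] := @lp_kkt _ _ _ M (col_mx h 0)
    (col_mx 0 (const_mx 1)) (col_mx 0 s0) (col_mx 0 (const_mx (-1))).
- rewrite mul_block_col !mulmx0 !add0r mulNmx mul1mx => k.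
  rewrite !mxE; case: (fintype.splitP k) => i _; rewrite !mxE.
    by rewrite lerNl -normrN ler_norm.
  by rewrite oppr_le0.
- by move=> k; rewrite !mxE; case: (fintype.splitP k) => i _; rewrite !mxE ?lerN10.
- rewrite tr_block_mx mul_block_col !mulmx0 !add0r !trmx0 mul0mx.
  rewrite linearN /= trmx1 mulNmx mul1mx; congr col_mx.
  by apply/matrixP => i j; rewrite !mxE opprK.
rewrite -[nu]vsubmxK -[ys]vsubmxK.
move: (usubmx nu) (dsubmx nu) (usubmx ys) (dsubmx ys) => {nu ys} nu mu y s.
rewrite tr_block_mx !mul_block_col !linearN /= !trmx1 !trmx0 !mulNmx !mul1mx !mul0mx.
rewrite addr0 add0r => /eq_col_mx[Bnu numu].
rewrite !opp_col_mx add_col_mx sub0r opprK => /complementary_col_mx[cnu cmu].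
(* The multiplier of [- s <= 0] is nonpositive, whence the sign. *)
exists (FCVar u phi nu (- mu) y s) => //; split=> //=.
by rewrite opprB -addrA [- _ + _]addrC lhsE -/u -/h addrCA -opprB.
Qed.

Lemma sp_value x tau z : sp_feasible P x tau z ->
  second_cost P (sp_y z) = dot (sp_nu z) (residual x (sp_u z)).
Proof.
move=> [_ Bnu /complementary_dot]; rewrite addrC lhsE dotNl => /eqP.
rewrite oppr_eq0 dotBr subr_eq0 => /eqP ->.
by rewrite second_costE -Bnu [LHS]dotC -dot_mulmx dotC.
Qed.

Lemma sp_weak_duality x tau z u y : sp_feasible P x tau z ->
  Yset P x u y -> dot (sp_nu z) (residual x u) <= second_cost P y.
Proof.
move=> [_ Bnu [nu0 _ _]] /subv_ge0/(dot_ge0 nu0).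
rewrite lhsE dotNl dotBr oppr_ge0 subr_le0.
by rewrite second_costE -Bnu [dot _ y]dotC -dot_mulmx [dot (_ *m _) _]dotC.
Qed.

Lemma sp_solvable_at x tau phi nu0 : Phi P phi -> lev nu0 0 ->
  (Bmx P)^T *m nu0 = cvec P -> Yset P x (scen P tau phi) !=set0 ->
  exists2 z, sp_feasible P x tau z & sp_phi z = phi.
Proof.
move=> Phiphi nu0le nu0c [y0 /YsetE Yy0].
have [y [nu [nuc cmp]]] := lp_kkt Yy0 nu0le nu0c.
exists (SPVar (scen P tau phi) phi nu y) => //; split=> //=.
by rewrite addrC lhsE.
Qed.

(** Common to FC and SP: [feas] is the set of solutions of the complementarity
    system, [ph] the normalized scenario and [val] the objective of a solution.
    One solution is picked at each vertex and the finitely many values are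
    compared; domination is required by all solutions at the vertex so that any
    choice will do. *)
Lemma best_vertex (W : Type) (feas : set W) (ph : W -> 'M[R]_(nI, nT))
    (val : W -> R) :
  (forall phi, Phi P phi -> exists2 v, feas v & ph v = phi) ->
  (forall v, feas v -> exists2 phi, vertices (Phi P) phi &
    forall v', feas v' -> ph v' = phi -> val v <= val v') ->
  exists v, [/\ feas v, vertices (Phi P) (ph v) &
    forall v', feas v' -> val v' <= val v].
Proof.
move=> ex dom.
have [v0 [fv0 _]] : exists v0, feas v0 /\ Phi P (ph v0).
  have [phi [Pphi _]] := Phi_vertex P; have [v fv vE] := ex _ Pphi.
  by exists v; rewrite vE.
have /boolp.choice[F FP] : forall phi, exists v, Phi P phi -> feas v /\ ph v = phi.
  move=> phi; have [/ex[v fv vE]|nPhi] := pselect (Phi P phi); last by exists v0.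
  by exists v.
have [phi Vphi phimax] := max_of_finite (fun phi => val (F phi))
  (Phi_finite_vertices P) (Phi_vertex P).
have [fF FE] := FP _ (proj1 Vphi).
exists (F phi); split=> // [|v /dom[phi' Vphi' le]]; first by rewrite FE.
by have [? ?] := FP _ (proj1 Vphi'); apply: le_trans (phimax _ Vphi'); exact: le.
Qed.

Lemma fc_optimal_exists x tau : exists v, fc_optimal P x tau v.
Proof.
apply: (best_vertex (feas := fc_feasible P x tau) (ph := @fc_phi _ _ _ _ _)
  (val := fun v => coord_sum (fc_s v))) => [phi|v fv].
  exact: fc_solvable_at.
have [G [k Gk]] := residual_affine (fc_nu v) x tau.
have [[Pv uE] _ _ _ _] := fv.
have [phi Vphi le] := Phi_vertex_above G Pv; exists phi => // v' fv' v'E.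
rewrite (fc_value fv) uE Gk (le_trans (_ : _ <= dot G phi + k)) ?lerD2r // -Gk.
have [[_ u'E] _ _ [_ + _] [_ s0 _]] := fv'; rewrite u'E v'E => sf.
apply: (fc_weak_duality fv s0 (y := fc_y v')).
by move: sf; rewrite opprB -addrA [- _ + _]addrC.
Qed.

Lemma sp_optimal_exists x tau nu0 : lev nu0 0 -> (Bmx P)^T *m nu0 = cvec P ->
  XR P tau x -> exists z, sp_optimal P x tau z.
Proof.
move=> nu0le nu0c xXR.
apply: (best_vertex (feas := sp_feasible P x tau) (ph := @sp_phi _ _ _ _ _)
  (val := fun z => second_cost P (sp_y z))) => [phi Pphi|z fz].
  by apply: sp_solvable_at nu0le nu0c _ => //; apply: xXR; exists phi.
have [G [k Gk]] := residual_affine (sp_nu z) x tau.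
have [[Pz uE] _ _] := fz.
have [phi Vphi le] := Phi_vertex_above G Pz; exists phi => // z' fz' z'E.
rewrite (sp_value fz) uE Gk (le_trans (_ : _ <= dot G phi + k)) ?lerD2r // -Gk.
have [[_ u'E] _ [_ sf _]] := fz'; apply: sp_weak_duality fz _.
by apply/subv_ge0; rewrite addrC -z'E -u'E.
Qed.

(** Every scenario carries an exact solution of FC; with a nonpositive optimum
    its slack vanishes, and its second stage is feasible. *)
Lemma fc_nonpositive x tau v : fc_optimal P x tau v ->
  ~ 0 < coord_sum (fc_s v) -> XR P tau x.
Proof.
move=> [_ _ vmax] /negP; rewrite -leNgt => v0 u [phi Pphi ->].
have [v' fv' v'E] := fc_solvable_at x tau Pphi.
have := le_trans (vmax _ fv') v0.
have [[_ uE] _ _ [_ sf _] [_ s0 _]] := fv'; rewrite uE v'E in sf => sum0.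
have sE k : fc_s v' k 0 = 0.
  have sk0 i : 0 <= fc_s v' i 0 by have := s0 i; rewrite mxE.
  apply/le_anti; rewrite sk0 andbT; apply: le_trans sum0.
  by rewrite /coord_sum (bigD1 k) //= lerDl sumr_ge0.
exists (fc_y v'); apply/subv_ge0; rewrite addrC.
suff s0E : fc_s v' = 0 by move: sf; rewrite s0E subr0.
by apply/colP => k; rewrite sE mxE.
Qed.

Lemma fc_le0_of_Yset x tau v y : fc_feasible P x tau v -> Yset P x (fc_u v) y ->
  coord_sum (fc_s v) <= 0.
Proof.
move=> fv Yy; rewrite (fc_value fv).
have -> : 0 = coord_sum (0 : 'cV[R]_m) by rewrite coord_sumE dot0r.
by apply: (fc_weak_duality fv (y := y)) => //; rewrite add0r; apply/subv_ge0.
Qed.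

End Subproblems.

(** * The master problem against the robust problem *)

Section MasterProblem.
Context (R : realType) (nI nT nx ny m : nat) (P : problem R nI nT nx ny m).
Implicit Types (x : 'cV[R]_nx) (tau : 'I_nI -> R) (phis : seq 'M[R]_(nI, nT)).
Implicit Types (p : plan R nI nx) (zeta : \bar R).

Lemma mp_lower_bound phis (w : mp_var R nI nT nx ny (size phis)) p zeta :
  mp_optimal P w -> Xset P (pl_x p) -> tau_ok P p ->
  (forall phi, phi \in phis -> exists2 y,
    Yset P (pl_x p) (scen P (pl_tau p) phi) y & ((second_cost P y)%:E <= zeta)%E) ->
  (mp_objective P w <= (first_cost P p)%:E + zeta)%E.
Proof.
move=> [_ wmin] Xp taup Hy.
have /boolp.choice[Y YP] : forall k : 'I_(size phis), exists y,
    Yset P (pl_x p) (scen P (pl_tau p) phis`_k) y /\ ((second_cost P y)%:E <= zeta)%E.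
  by move=> k; have [|y Yy cy] := Hy phis`_k; [exact: mem_nth|exists y].
apply: (wmin (MPVar p zeta Y (fun k => scen P (pl_tau p) phis`_k))).
by split=> // k; have [Yk ck] := YP k.
Qed.

Lemma mp_stored phis (w : mp_var R nI nT nx ny (size phis)) phi :
  mp_feasible P w -> phi \in phis ->
  exists2 y, Yset P (pl_x (mp_plan w)) (scen P (pl_tau (mp_plan w)) phi) y &
    ((second_cost P y)%:E <= mp_zeta w)%E.
Proof.
move=> [_ _ H] phiin; have kP : (index phi phis < size phis)%N by rewrite index_mem.
have [cy Yy uE] := H (Ordinal kP); exists (mp_y w (Ordinal kP)) => //.
by rewrite uE /= nth_index in Yy.
Qed.

(** The inner infima need be neither attained nor finite, hence the detour
    through real numbers above the worst-case cost. *)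
Lemma mp_le_ddu phis (w : mp_var R nI nT nx ny (size phis)) p :
  mp_optimal P w -> (forall phi, phi \in phis -> Phi P phi) ->
  ddu_feasible P p -> (mp_objective P w <= ddu_objective P p)%E.
Proof.
move=> wopt phisP [[Xp XRp] taup]; rewrite /ddu_objective; set S := ereal_sup _.
have le_r (r : R) : (S < r%:E)%E -> (mp_objective P w <= (first_cost P p)%:E + r%:E)%E.
  move=> Sr; apply: mp_lower_bound => // phi /phisP Pphi.
  have [|_ [y Yy <-] yr] := @ereal_inf_lt _ [set (second_cost P y)%:E |
      y in Yset P (pl_x p) (scen P (pl_tau p) phi)] r%:E.
    apply: le_lt_trans Sr; apply: ereal_sup_ubound.
    by exists (scen P (pl_tau p) phi) => //; exists phi.
  by exists y => //; exact: ltW.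
case: S le_r => [s| |] le_r.
- apply/lee_addgt0Pr => e e0; rewrite -addeA -EFinD; apply: le_r.
  by rewrite lte_fin ltrDl.
- by rewrite addey // leey.
- case: (mp_objective P w) le_r => [r| |] le_r; last by [].
    have := le_r (r - 1 - first_cost P p) (ltNyr _).
    by rewrite -EFinD lee_fin addrC subrK lerDl oppr_ge0 ler10.
  by have := le_r 0 (ltNyr _).
Qed.

(** The multiplier of an optimal solution of SP is dual feasible for every
    scenario, so SP is solvable at every scenario of the uncertainty set and its
    optimum bounds the optimal second-stage cost there. *)
Lemma sp_dominates x tau z phi : sp_optimal P x tau z -> XR P tau x -> Phi P phi ->
  exists2 y, Yset P x (scen P tau phi) y & second_cost P y <= second_cost P (sp_y z).
Proof.
move=> [[_ nuc [nu0 _ _]] _ zmax] xXR Pphi.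
have nule : lev (sp_nu z) 0 by move=> k; have := nu0 k; rewrite !mxE oppr_ge0.
have [|z' fz' z'E] := sp_solvable_at (x := x) (tau := tau) Pphi nule nuc.
  by apply: xXR; exists phi.
exists (sp_y z'); last exact: zmax.
have [[_ uE] _ [_ + _]] := fz'; rewrite uE z'E => sf.
by apply/subv_ge0; rewrite addrC.
Qed.

Lemma mp_le_sp phis (w : mp_var R nI nT nx ny (size phis)) z :
  mp_optimal P w -> (forall phi, phi \in phis -> Phi P phi) ->
  XR P (pl_tau (mp_plan w)) (pl_x (mp_plan w)) ->
  sp_optimal P (pl_x (mp_plan w)) (pl_tau (mp_plan w)) z ->
  (mp_objective P w <= (first_cost P (mp_plan w) + second_cost P (sp_y z))%:E)%E.
Proof.
move=> wopt phisP xXR zopt; rewrite EFinD; have [[Xw tauw _] _] := wopt.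
apply: mp_lower_bound => // phi /phisP Pphi.
by have [y Yy cy] := sp_dominates zopt xXR Pphi; exists y.
Qed.

Lemma ddu_le_sp p z : sp_optimal P (pl_x p) (pl_tau p) z ->
  XR P (pl_tau p) (pl_x p) ->
  (ddu_objective P p <= (first_cost P p + second_cost P (sp_y z))%:E)%E.
Proof.
move=> zopt xXR; rewrite EFinD leeD2l //; apply: ge_ereal_sup => _ [u [phi Pphi ->] <-].
have [y Yy cy] := sp_dominates zopt xXR Pphi.
by apply: (@le_trans _ _ (second_cost P y)%:E) => //; apply: ereal_inf_lbound; exists y.
Qed.

Lemma fc_cut_new phis (w : mp_var R nI nT nx ny (size phis)) v :
  mp_feasible P w ->
  fc_feasible P (pl_x (mp_plan w)) (pl_tau (mp_plan w)) v ->
  0 < coord_sum (fc_s v) -> fc_phi v \notin phis.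
Proof.
move=> fw fv; rewrite ltNge; apply: contra => /(mp_stored fw)[y Yy _].
by have [[_ uE] _ _ _ _] := fv; apply: (fc_le0_of_Yset fv (y := y)); rewrite uE.
Qed.

Lemma sp_cut_new phis (w : mp_var R nI nT nx ny (size phis)) z (eps : R) :
  mp_optimal P w -> (forall phi, phi \in phis -> Phi P phi) ->
  XR P (pl_tau (mp_plan w)) (pl_x (mp_plan w)) ->
  sp_optimal P (pl_x (mp_plan w)) (pl_tau (mp_plan w)) z ->
  0 <= eps ->
  ~ (`|(first_cost P (mp_plan w) + second_cost P (sp_y z))%:E - mp_objective P w|
     <= eps%:E)%E ->
  sp_phi z \notin phis.
Proof.
move=> wopt phisP xXR zopt eps0 gap; apply/negP => zin; apply: gap.
have [fz _ _] := zopt; have [[_ zu] _ _] := fz.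
have [y Yy cy] := mp_stored (proj1 wopt) zin.
have zy : ((second_cost P (sp_y z))%:E <= mp_zeta w)%E.
  apply: le_trans cy; rewrite lee_fin (sp_value fz).
  by apply: sp_weak_duality fz _; rewrite zu.
suff <- : (first_cost P (mp_plan w) + second_cost P (sp_y z))%:E = mp_objective P w.
  by rewrite subee // abse0 lee_fin.
by apply/le_anti; rewrite [X in _ && X]mp_le_sp // andbT EFinD leeD2l.
Qed.

(** One stored vertex suffices: along a direction [d] that keeps the second
    stage feasible and lowers its cost, [y + d] would improve an optimal
    solution of the master problem. *)
Lemma dual_feasible_of_solvable : mp_solvable P ->
  exists2 nu, lev nu 0 & (Bmx P)^T *m nu = cvec P.
Proof.
move=> solv; have [phi Vphi] := Phi_vertex P.
have [|w wopt] := solv [:: phi].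
  by move=> phi'; rewrite inE => /eqP ->.
apply: dual_feasible => d Bd; rewrite leNgt; apply/negP => cd.
have [[Xw tauw _] _] := wopt; have [|y Yy cy] := mp_stored (phi := phi) (proj1 wopt).
  by rewrite inE.
have := mp_lower_bound (zeta := (second_cost P (y + d))%:E) wopt Xw tauw.
have -> : mp_objective P w = ((first_cost P (mp_plan w))%:E + mp_zeta w)%E by [].
rewrite leeD2lE // => H.
have /H : forall phi', phi' \in [:: phi] -> exists2 y',
    Yset P (pl_x (mp_plan w)) (scen P (pl_tau (mp_plan w)) phi') y' &
    ((second_cost P y')%:E <= (second_cost P (y + d))%:E)%E.
  move=> phi'; rewrite inE => /eqP ->; exists (y + d) => //.
  apply/YsetE; move/YsetE: Yy => Yy k; rewrite mulmxDr mxE -[leRHS]addr0.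
  by apply: lerD => //; have := Bd k; rewrite [leRHS]mxE.
by move=> /(le_trans cy); rewrite lee_fin !second_costE dotDr lerDl leNgt cd.
Qed.

End MasterProblem.

(** * Executions of the algorithm *)

Section Executions.
Context (R : realType) (nI nT nx ny m : nat) (P : problem R nI nT nx ny m).
Implicit Types (phis : seq 'M[R]_(nI, nT)).

Lemma uniq_size_nU phis : uniq phis ->
  (forall phi, phi \in phis -> vertices (Phi P) phi) ->
  (size phis <= nU P)%N.
Proof.
move=> uphis phisV; rewrite /nU; apply: uniq_leq_size => // phi /phisV Vphi.
by rewrite in_fset_set ?inE //; exact: Phi_finite_vertices.
Qed.

(** Each iteration that does not stop stores exactly one new vertex, so the
    number of stored vertices is the number of iterations; the last iteration
    stores none, whence the successor in the second case. *)
Definition invariant (eps : R) (n : nat) (s : status R nI nT nx) : Prop :=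
  match s with
  | Running phis _ =>
      [/\ size phis = n, uniq phis & forall phi, phi \in phis -> vertices (Phi P) phi]
  | Stopped p => ddu_optimal P eps p /\ (n <= (nU P).+1)%N
  end.

Lemma ddu_optimal_of_gap phis (w : mp_var R nI nT nx ny (size phis)) z (eps : R) :
  mp_optimal P w -> (forall phi, phi \in phis -> Phi P phi) ->
  XR P (pl_tau (mp_plan w)) (pl_x (mp_plan w)) ->
  sp_optimal P (pl_x (mp_plan w)) (pl_tau (mp_plan w)) z ->
  (`|(first_cost P (mp_plan w) + second_cost P (sp_y z))%:E - mp_objective P w|
     <= eps%:E)%E ->
  ddu_optimal P eps (mp_plan w).
Proof.
move=> wopt phisP xXR zopt gap; have [[Xw tauw _] _] := wopt.
split=> // p' fp'; apply: le_trans (ddu_le_sp zopt xXR) _.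
apply: le_trans (_ : _ <= mp_objective P w + eps%:E)%E _; last first.
  by apply: leeD2r; exact: mp_le_ddu.
case: (mp_objective P w) gap => [r| |] //=; rewrite -?EFinB -?EFinD !lee_fin.
by rewrite ler_norml => /andP[_]; rewrite lerBlDl.
Qed.

Lemma iteration_invariant (eps : R) n s s' : 0 <= eps ->
  invariant eps n s -> iteration P eps s s' -> invariant eps n.+1 s'.
Proof.
move=> eps0 inv it; case: it inv => [phis UB w v wopt vopt pos|
  phis UB w v z wopt vopt npos zopt LB UB' gap|
  phis UB w v z wopt vopt npos zopt LB UB' gap] [sz un phisV];
  have phisP phi : phi \in phis -> Phi P phi by move=> /phisV[].
- have [fv Vv _] := vopt; split.
  + by rewrite size_rcons sz.
  + by rewrite rcons_uniq un andbT; apply: fc_cut_new fv pos; case: wopt.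
  + by move=> phi; rewrite mem_rcons inE => /predU1P[->//|/phisV].
- have xXR := fc_nonpositive vopt npos; have [_ Vz _] := zopt; split.
  + by rewrite size_rcons sz.
  + by rewrite rcons_uniq un andbT; exact: sp_cut_new gap.
  + by move=> phi; rewrite mem_rcons inE => /predU1P[->//|/phisV].
- have xXR := fc_nonpositive vopt npos; split; first exact: ddu_optimal_of_gap gap.
  by rewrite ltnS -sz uniq_size_nU.
Qed.

Lemma run_invariant (eps : R) n s : 0 <= eps -> run P eps n s -> invariant eps n s.
Proof.
by move=> eps0; elim=> [//|k s1 s2 _ IH]; exact: iteration_invariant.
Qed.

Lemma nU_gt0 : (0 < nU P)%N.
Proof.
have [phi Vphi] := Phi_vertex P.
by apply: (uniq_size_nU (phis := [:: phi])) => // phi'; rewrite inE => /eqP ->.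
Qed.

Lemma iteration_progress (eps : R) phis UB :
  (forall phi, phi \in phis -> vertices (Phi P) phi) -> mp_solvable P ->
  exists s', iteration P eps (Running phis UB) s'.
Proof.
move=> phisV solv; have [w wopt] := solv phis phisV.
have [v vopt] := fc_optimal_exists P (pl_x (mp_plan w)) (pl_tau (mp_plan w)).
have [pos|npos] := pselect (0 < coord_sum (fc_s v)).
  exists (Running (rcons phis (fc_phi v)) UB).
  exact: iter_feasibility_cut wopt vopt pos.
have [nu nule nuc] := dual_feasible_of_solvable solv.
have [z zopt] := sp_optimal_exists nule nuc (fc_nonpositive vopt npos).
have [gap|gap] := pselect (`|(first_cost P (mp_plan w) + second_cost P (sp_y z))%:E
    - mp_objective P w| <= eps%:E)%E.
  by exists (Stopped (mp_plan w)); exact: iter_stop wopt vopt npos zopt gap.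
by eexists; exact: iter_optimality_cut wopt vopt npos zopt gap.
Qed.

End Executions.

Theorem theorem1 (R : realType) :
  exists c : nat,
  forall (nI nT nx ny m : nat) (P : problem R nI nT nx ny m) (eps : R),
    0 <= delta P < 1 ->
    0 <= xi P < 1 ->
    0 < mhat P ->
    (forall i, 0 < sigma2U P i) ->
    0 <= eps ->
    finite_set (vertices (Phi P)) /\
    forall (n : nat) (s : status R nI nT nx),
      run P eps n s ->
      [/\ (n <= c * nU P)%N,
          forall p : plan R nI nx, s = Stopped p -> ddu_optimal P eps p
        & forall (phis : seq 'M[R]_(nI, nT)) (UB : \bar R),
            s = Running phis UB -> mp_solvable P ->
            exists s' : status R nI nT nx, iteration P eps s s'].
Proof.
exists 2 => nI nT nx ny m P eps _ _ _ _ eps0; split; first exact: Phi_finite_vertices.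
move=> n s /(run_invariant eps0) inv.
have nU0 := nU_gt0 P.
split.
- have le : (n <= (nU P).+1)%N.
    case: s inv => [phis UB [<- un phisV]|p [_ ->]//].
    by rewrite leqW // uniq_size_nU.
  by rewrite (leq_trans le) // mul2n -addnn -addn1 leq_add2l.
- by move=> p sE; move: inv; rewrite sE => -[].
- move=> phis UB sE solv; move: inv; rewrite sE => -[_ _ phisV].
  exact: iteration_progress.
Qed.
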